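(* Let $M$ be a pointed metric space with base point $0$ and let $f:M\to M$ be a Lipschitz map such that $f(0)=0$. If the set $\mathrm{Per}(f)$ of periodic points of $f$ is dense in $M$, then the set $\mathrm{Per}(\widehat{f})$ of periodic points of $\widehat{f}$ is dense in $\mathcal{F}(M)$.
   Context: For a metric space $(M,d)$ with base point $0$, $\mathrm{Lip}_0(M)$ is the real Banach space of Lipschitz functions $M\to\mathbb{R}$ vanishing at $0$, with norm the best Lipschitz constant. For $x\in M$, $\delta(x)\in \mathrm{Lip}_0(M)^*$ is the evaluation $\langle \varphi,\delta(x)\rangle=\varphi(x)$. The Lipschitz-free space is $\mathcal{F}(M)=\overline{\mathrm{span}}^{\|\cdot\|}\{\delta(x):x\in M\}\subset \mathrm{Lip}_0(M)^*$. If $f:M\to M$ is Lipschitz with $f(0)=0$, $\widehat{f}:\mathcal{F}(M)\to\mathcal{F}(M)$ is the unique bounded linear operator with $\widehat{f}(\delta(x))=\delta(f(x))$ for all $x\in M$. A point $x$ is periodic for a self-map $F$ if $F^n(x)=x$ for some integer $n\ge1$; $\mathrm{Per}(F)$ is the set of all periodic points. *)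

(* Defs.v *)
From HB Require Import structures.
From mathcomp Require Import all_boot all_order all_algebra.
From mathcomp Require Import all_classical all_reals all_analysis.

Set Implicit Arguments.
Unset Strict Implicit.
Unset Printing Implicit Defensive.

Import Order.TTheory GRing.Theory Num.Theory.
Import numFieldNormedType.Exports.

Local Open Scope classical_set_scope.
Local Open Scope ring_scope.

Definition Per (X : Type) (F : X -> X) : set X :=
  [set x | exists n : nat, (1 <= n)%N /\ iter n F x = x].

(* The distance on [R^o] is [`|y - x|]. *)
Definition klipschitz (R : realType) (X Y : metricType R) (k : R)
    (f : X -> Y) : Prop :=
  forall x y : X, mdist (f x) (f y) <= k * mdist x y.

Definition is_lipschitz (R : realType) (X Y : metricType R)
    (f : X -> Y) : Prop :=
  exists k : R, 0 <= k /\ klipschitz k f.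

Definition bounded_by (R : realType) (V W : normedModType R) (k : R)
    (T : V -> W) : Prop :=
  forall v : V, `|T v| <= k * `|v|.

Definition bounded_op (R : realType) (V W : normedModType R)
    (T : V -> W) : Prop :=
  exists k : R, 0 <= k /\ bounded_by k T.

Definition linspan (R : realType) (V : lmodType R) (A : set V) : set V :=
  [set v | exists (n : nat) (a : 'I_n -> R) (u : 'I_n -> V),
     (forall i, A (u i)) /\ v = \sum_(i < n) a i *: u i].

Lemma le_inf_mul (R : realType) (A : set R) (a c : R) :
  A !=set0 -> 0 <= c -> (forall k, A k -> a <= k * c) -> a <= inf A * c.
Proof.
move=> [k0 Ak0]; rewrite le_eqVlt => /predU1P[<-|c0] H.
  by have := H _ Ak0; rewrite !mulr0.
rewrite -ler_pdivrMr//; apply: lb_le_inf; first by exists k0.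
by move=> k Ak; rewrite ler_pdivrMr//; exact: H.
Qed.

Lemma ge0_inf (R : realType) (A : set R) :
  A !=set0 -> (forall k, A k -> 0 <= k) -> 0 <= inf A.
Proof. by move=> A0 H; exact: lb_le_inf. Qed.

Lemma ge0_inf_le (R : realType) (A : set R) (k : R) :
  (forall k, A k -> 0 <= k) -> A k -> inf A <= k.
Proof. by move=> H Ak; apply: ge_inf => //; exists 0. Qed.

Section lip0.
Context {R : realType} {M : metricType R} (o : M).

Definition lip0_pred : {pred M -> R^o} :=
  mem [set phi : M -> R^o | is_lipschitz phi /\ phi o = 0].

Lemma klipschitzE (k : R) (phi : M -> R^o) :
  klipschitz k phi <-> forall x y, `|phi x - phi y| <= k * mdist x y.
Proof. by split=> H x y; have := H x y; rewrite /mdist/= distrC. Qed.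

Lemma lip0_submod_closed : submod_closed lip0_pred.
Proof.
split; first by rewrite inE/=; split=> //; exists 0; split=> //;
  apply/klipschitzE => x y; rewrite subrr normr0 mul0r.
move=> a f g; rewrite !inE/=.
move=> [[k [k0 /klipschitzE Hf]] f0] [[l [l0 /klipschitzE Hg]] g0]; split.
  exists (`|a| * k + l); split; first by rewrite addr_ge0// mulr_ge0.
  apply/klipschitzE => x y.
  have -> : (a *: f + g) x - (a *: f + g) y = a * (f x - f y) + (g x - g y).
    by rewrite mulrBr addrACA -opprD.
  rewrite (le_trans (ler_normD _ _))// mulrDl lerD// normrM -mulrA.
  by rewrite ler_wpM2l.
have -> : (a *: f + g) o = a * f o + g o by [].
by rewrite f0 g0 mulr0 addr0.
Qed.

HB.instance Definition _ :=
  GRing.isSubmodClosed.Build _ _ lip0_pred lip0_submod_closed.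

Record lip0 := Lip0 { lip0_fun :> M -> R^o ; _ : lip0_fun \in lip0_pred }.

HB.instance Definition _ := [isSub for lip0_fun].
HB.instance Definition _ := [Choice of lip0 by <:].
HB.instance Definition _ := [SubChoice_isSubLmodule of lip0 by <:].

Lemma lip0P (phi : lip0) : is_lipschitz phi /\ phi o = 0.
Proof. by case: phi => phi /= /set_mem. Qed.

Lemma lip0D (phi psi : lip0) x : (phi + psi) x = phi x + psi x.
Proof. by []. Qed.

Lemma lip0Z a (phi : lip0) x : (a *: phi) x = a * phi x.
Proof. by []. Qed.

(* The constraint [0 <= k] only matters for a one-point [M], where every real
   number [k] satisfies [klipschitz k phi]. *)
Definition lip0_norm (phi : lip0) : R :=
  inf [set k : R | 0 <= k /\ klipschitz k phi].

Let lip0_set0 (phi : lip0) : [set k : R | 0 <= k /\ klipschitz k phi] !=set0.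
Proof. by have [[k Hk] _] := lip0P phi; exists k. Qed.

Lemma lip0_norm_ge0 phi : 0 <= lip0_norm phi.
Proof. by apply: ge0_inf => // k []. Qed.

Lemma lip0_normP (phi : lip0) x y :
  `|phi x - phi y| <= lip0_norm phi * mdist x y.
Proof.
by apply: le_inf_mul => //; [exact: mdist_ge0|move=> k [_ /klipschitzE]; exact].
Qed.

Lemma lip0_norm_le (phi : lip0) k : 0 <= k ->
  (forall x y, `|phi x - phi y| <= k * mdist x y) -> lip0_norm phi <= k.
Proof.
by move=> k0 H; apply: ge0_inf_le => [l []//|]; split=> //; exact/klipschitzE.
Qed.

Lemma lip0_normD phi psi :
  lip0_norm (phi + psi) <= lip0_norm phi + lip0_norm psi.
Proof.
apply: lip0_norm_le; first by rewrite addr_ge0// lip0_norm_ge0.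
move=> x y; rewrite !lip0D opprD addrACA mulrDl.
by rewrite (le_trans (ler_normD _ _))// lerD// lip0_normP.
Qed.

Let lip0_normZ_le a phi : lip0_norm (a *: phi) <= `|a| * lip0_norm phi.
Proof.
apply: lip0_norm_le; first by rewrite mulr_ge0// lip0_norm_ge0.
move=> x y; rewrite !lip0Z -mulrBr normrM -mulrA.
by rewrite ler_wpM2l// lip0_normP.
Qed.

Lemma lip0_normZ a phi : lip0_norm (a *: phi) = `|a| * lip0_norm phi.
Proof.
apply/eqP; rewrite eq_le lip0_normZ_le/=.
have [->|a0] := eqVneq a 0; first by rewrite normr0 mul0r lip0_norm_ge0.
rewrite -ler_pdivlMl ?normr_gt0// -normfV.
by rewrite (le_trans _ (lip0_normZ_le _ _))// scalerA mulVf// scale1r.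
Qed.

Lemma lip0_norm0_eq0 phi : lip0_norm phi = 0 -> phi = 0.
Proof.
move=> H; apply/val_inj/funext => x /=; apply/eqP.
have := lip0_normP phi x o; rewrite H mul0r (lip0P phi).2 subr0 normr_le0.
by [].
Qed.

HB.instance Definition _ :=
  Lmodule_isNormed.Build R lip0 lip0_normD lip0_normZ lip0_norm0_eq0.

End lip0.

Section dualspace.
Context {R : realType} (V : normedModType R).

Definition dual_pred : {pred V -> R^o} :=
  mem [set l : V -> R^o | linear l /\ bounded_op l].

Lemma dual_submod_closed : submod_closed dual_pred.
Proof.
split.
  rewrite inE/=; split; first by move=> a u v /=; rewrite scaler0 addr0.
  by exists 0; split=> // v; rewrite normr0 mul0r.
move=> a f g; rewrite !inE/= => -[lf [k [k0 Hf]]] [lg [l [l0 Hg]]]; split.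
  move=> b u v.
  have E w : (a *: f + g) w = a * f w + g w by [].
  rewrite !E lf lg scalerDr /GRing.scale/= !mulrDr.
  by rewrite mulrCA addrACA.
exists (`|a| * k + l); split; first by rewrite addr_ge0// mulr_ge0.
move=> v; have -> : (a *: f + g) v = a * f v + g v by [].
rewrite (le_trans (ler_normD _ _))// mulrDl lerD//.
  by rewrite normrM -mulrA ler_wpM2l//; exact: Hf.
Qed.

HB.instance Definition _ :=
  GRing.isSubmodClosed.Build _ _ dual_pred dual_submod_closed.

Record dualspace :=
  DualSpace { dual_fun :> V -> R^o ; _ : dual_fun \in dual_pred }.

HB.instance Definition _ := [isSub for dual_fun].
HB.instance Definition _ := [Choice of dualspace by <:].
HB.instance Definition _ := [SubChoice_isSubLmodule of dualspace by <:].

Lemma dualP (l : dualspace) : linear l /\ bounded_op l.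
Proof. by case: l => l /= /set_mem. Qed.

Lemma dualD (l m : dualspace) v : (l + m) v = l v + m v.
Proof. by []. Qed.

Lemma dualZ a (l : dualspace) v : (a *: l) v = a * l v.
Proof. by []. Qed.

(* Same remark as for [lip0_norm] when [V] is trivial. *)
Definition dual_norm (l : dualspace) : R :=
  inf [set k : R | 0 <= k /\ bounded_by k l].

Let dual_set0 (l : dualspace) : [set k : R | 0 <= k /\ bounded_by k l] !=set0.
Proof. by have [_ [k Hk]] := dualP l; exists k. Qed.

Lemma dual_norm_ge0 l : 0 <= dual_norm l.
Proof. by apply: ge0_inf => // k []. Qed.

Lemma dual_normP (l : dualspace) v : `|l v| <= dual_norm l * `|v|.
Proof. by apply: le_inf_mul => // k [_]; exact. Qed.

Lemma dual_norm_le (l : dualspace) k : 0 <= k ->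
  (forall v, `|l v| <= k * `|v|) -> dual_norm l <= k.
Proof. by move=> k0 H; apply: ge0_inf_le => [m []|]. Qed.

Lemma dual_normD l m : dual_norm (l + m) <= dual_norm l + dual_norm m.
Proof.
apply: dual_norm_le; first by rewrite addr_ge0// dual_norm_ge0.
move=> v; rewrite dualD mulrDl (le_trans (ler_normD _ _))//.
by rewrite lerD// dual_normP.
Qed.

Let dual_normZ_le a l : dual_norm (a *: l) <= `|a| * dual_norm l.
Proof.
apply: dual_norm_le; first by rewrite mulr_ge0// dual_norm_ge0.
by move=> v; rewrite dualZ normrM -mulrA ler_wpM2l// dual_normP.
Qed.

Lemma dual_normZ a l : dual_norm (a *: l) = `|a| * dual_norm l.
Proof.
apply/eqP; rewrite eq_le dual_normZ_le/=.
have [->|a0] := eqVneq a 0; first by rewrite normr0 mul0r dual_norm_ge0.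
rewrite -ler_pdivlMl ?normr_gt0// -normfV.
by rewrite (le_trans _ (dual_normZ_le _ _))// scalerA mulVf// scale1r.
Qed.

Lemma dual_norm0_eq0 l : dual_norm l = 0 -> l = 0.
Proof.
move=> H; apply/val_inj/funext => v /=; apply/eqP.
by have := dual_normP l v; rewrite H mul0r normr_le0.
Qed.

HB.instance Definition _ :=
  Lmodule_isNormed.Build R dualspace dual_normD dual_normZ dual_norm0_eq0.

End dualspace.

Section closure_span.
Context {R : realType} {V : normedModType R}.

Lemma closure_normP (A : set V) v :
  closure A v <-> forall e : R, 0 < e -> exists2 u, A u & `|v - u| < e.
Proof.
split=> [Av e e0|H B].
  have [u [Au]] := Av _ (nbhsx_ballx v _ e0).
  by rewrite -ball_normE/= => uv; exists u.
move=> /nbhs_ballP[e /= e0 vB]; have [u Au uv] := H _ e0.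
by exists u; split=> //; apply: vB; rewrite -ball_normE.
Qed.

Lemma linspanD (A : set V) u v :
  linspan A u -> linspan A v -> linspan A (u + v).
Proof.
move=> [m [a [s [As ->]]]] [n [b [t [At ->]]]].
exists (m + n)%N,
  (fun i : 'I_(m + n) =>
     match fintype.split i with inl j => a j | inr j => b j end),
  (fun i : 'I_(m + n) =>
     match fintype.split i with inl j => s j | inr j => t j end); split.
  by move=> i; case: (fintype.split i).
rewrite big_split_ord/=; congr (_ + _); apply: eq_bigr => i _.
  by rewrite (unsplitK (inl i)).
by rewrite (unsplitK (inr i)).
Qed.

Lemma linspanZ (A : set V) (c : R) u : linspan A u -> linspan A (c *: u).
Proof.
move=> [m [a [s [As ->]]]]; exists m, (fun i => c * a i), s; split=> //.
by rewrite scaler_sumr; apply: eq_bigr => i _; rewrite scalerA.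
Qed.

Lemma linspan0 (A : set V) : linspan A 0.
Proof.
by exists 0%N, (fun=> 0), (fun=> 0); split; [case|rewrite big_ord0].
Qed.

Lemma linspan_sub (A : set V) u : A u -> linspan A u.
Proof.
by move=> Au; exists 1%N, (fun=> 1), (fun=> u); rewrite big_ord1 scale1r.
Qed.

Lemma closure_linspan_submod (A : set V) :
  submod_closed (mem (closure (linspan A))).
Proof.
split; first by rewrite inE; apply: subset_closure; exact: linspan0.
move=> a u v; rewrite !inE => /closure_normP Hu /closure_normP Hv.
apply/closure_normP => e e0.
have a1 : 0 < `|a| + 1 by rewrite ltr_pwDr.
have e2 : 0 < e / 2 by rewrite divr_gt0.
have [u' Au' uu'] := Hu _ (divr_gt0 e2 a1); have [v' Av' vv'] := Hv _ e2.
exists (a *: u' + v'); first by apply: linspanD => //; exact: linspanZ.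
rewrite opprD addrACA -scalerBr (splitr e) (le_lt_trans (ler_normD _ _))//.
rewrite ler_ltD// normrZ; move: uu'; rewrite ltr_pdivlMr// => /ltW.
by apply: le_trans; rewrite mulrC ler_wpM2l// lerDl.
Qed.

End closure_span.

Section free_space.
Context {R : realType} {M : metricType R} (o : M).

Lemma eval_dual (x : M) :
  (fun phi : lip0 o => phi x) \in @dual_pred R (lip0 o).
Proof.
rewrite inE/=; split=> //; exists (mdist x o); split; first exact: mdist_ge0.
move=> phi; rewrite mulrC; have := lip0_normP phi x o.
by rewrite (lip0P phi).2 subr0.
Qed.

Definition delta_dual (x : M) : dualspace (lip0 o) := DualSpace (eval_dual x).

Definition free_pred : {pred dualspace (lip0 o)} :=
  mem (closure (linspan (range delta_dual))).

HB.instance Definition _ :=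
  GRing.isSubmodClosed.Build _ _ free_pred
    (closure_linspan_submod (range delta_dual)).

Record lipfree :=
  LipFree { free_val :> dualspace (lip0 o) ; _ : free_val \in free_pred }.

HB.instance Definition _ := [isSub for free_val].
HB.instance Definition _ := [Choice of lipfree by <:].
HB.instance Definition _ := [SubChoice_isSubLmodule of lipfree by <:].

Definition free_norm (m : lipfree) : R := `|free_val m|.

Lemma free_normD m n : free_norm (m + n) <= free_norm m + free_norm n.
Proof. exact: ler_normD. Qed.

Lemma free_normZ a m : free_norm (a *: m) = `|a| * free_norm m.
Proof. exact: normrZ. Qed.

Lemma free_norm0_eq0 m : free_norm m = 0 -> m = 0.
Proof. by move=> /normr0_eq0 H; exact/val_inj. Qed.

HB.instance Definition _ :=
  Lmodule_isNormed.Build R lipfree free_normD free_normZ free_norm0_eq0.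

Lemma delta_free (x : M) : delta_dual x \in free_pred.
Proof. by rewrite inE; apply/subset_closure/linspan_sub; exists x. Qed.

Definition delta (x : M) : lipfree := LipFree (delta_free x).

Lemma free_dense (m : lipfree) (e : R) : 0 < e ->
  exists n (a : 'I_n -> R) (x : 'I_n -> M),
    `|m - \sum_(i < n) a i *: delta (x i)| < e.
Proof.
move=> e0; have /set_mem/closure_normP/(_ _ e0) := valP m.
move=> [_ [n [a [u [Hu ->]]]] mu].
have /choice[x xE] : forall i, exists x, delta_dual x = u i.
  by move=> i; have [x _ xE] := Hu i; exists x.
exists n, a, x; set s := \sum_(i < n) _.
have sE : free_val s = \sum_(i < n) a i *: u i.
  rewrite -[free_val s]/(val s) raddf_sum/=.
  by apply: eq_bigr => i _; rewrite -xE.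
by move: mu; rewrite -sE.
Qed.

End free_space.

Section linearization.
Context {R : realType} {M : metricType R} (o : M) (f : M -> M).

Definition is_linearization (T : lipfree o -> lipfree o) : Prop :=
  bounded_op T /\ forall x : M, T (delta o x) = delta o (f x).

Lemma linearization_unique (S T : {linear lipfree o -> lipfree o}) :
  is_linearization S -> is_linearization T -> S =1 T.
Proof.
move=> [[k [k0 Sk]] Sd] [[l [l0 Tl]] Td] m.
apply/eqP; rewrite -subr_eq0 -normr_le0; apply/ler_addgt0Pl => e e0.
have kl : 0 < k + l + 1 by rewrite ltr_pwDr// addr_ge0.
have [n [a [x]]] := free_dense m (divr_gt0 e0 kl).
set s := \sum_(i < n) _ => ms.
have ST : S s = T s.
  by rewrite !linear_sum; apply: eq_bigr => i _; rewrite !linearZ/= Sd Td.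
have -> : S m - T m = S (m - s) - T (m - s).
  by rewrite (raddfB S) (raddfB T)/= ST opprB addrA subrK.
rewrite addr0 (le_trans (ler_normB _ _))// (le_trans (lerD (Sk _) (Tl _)))//.
rewrite -mulrDl; move: ms; rewrite ltr_pdivlMr// => /ltW.
by apply: le_trans; rewrite mulrC ler_wpM2l// lerDl.
Qed.

Hypotheses (lipf : is_lipschitz f) (f0 : f o = o).

Let pull_in (phi : lip0 o) : (phi \o f : M -> R^o) \in lip0_pred o.
Proof.
have [[k [k0 Hk]] p0] := lip0P phi; have [l [l0 Hl]] := lipf.
rewrite inE/=; split; last by rewrite f0.
exists (k * l); split; first exact: mulr_ge0.
by move=> x y; rewrite (le_trans (Hk _ _))// -mulrA ler_wpM2l.
Qed.

Let pull (phi : lip0 o) : lip0 o := Lip0 (pull_in phi).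

Let adj_bound (k : R) : 0 <= k -> klipschitz k f ->
  forall (l : dualspace (lip0 o)) phi, `|l (pull phi)| <= k * `|l| * `|phi|.
Proof.
move=> k0 Hk l phi; apply: le_trans (dual_normP _ _) _.
rewrite [leRHS]mulrAC [leRHS]mulrC.
apply: ler_wpM2l; first exact: dual_norm_ge0.
apply: lip0_norm_le => [|x y]; first by rewrite mulr_ge0.
apply: le_trans (lip0_normP phi (f x) (f y)) _; rewrite [k * _]mulrC -mulrA.
by apply: ler_wpM2l => //; exact: lip0_norm_ge0.
Qed.

Let adj_in (l : dualspace (lip0 o)) :
  (l \o pull : lip0 o -> R^o) \in @dual_pred R (lip0 o).
Proof.
have [k [k0 Hk]] := lipf; rewrite inE/=; split.
  move=> a phi psi /=; rewrite -(dualP l).1; congr (l _); exact/val_inj.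
exists (k * `|l|); split; first by rewrite mulr_ge0.
by move=> phi; exact: adj_bound.
Qed.

Let adj (l : dualspace (lip0 o)) : dualspace (lip0 o) := DualSpace (adj_in l).

Let adj_linear : linear adj.
Proof. by move=> a l m; exact/val_inj. Qed.

HB.instance Definition _ :=
  GRing.isLinear.Build R (dualspace (lip0 o)) (dualspace (lip0 o)) _ adj
    adj_linear.

Let adj_norm (k : R) : 0 <= k -> klipschitz k f ->
  forall l, `|adj l| <= k * `|l|.
Proof.
move=> k0 Hk l; apply: dual_norm_le; first by rewrite mulr_ge0.
by move=> phi; exact: adj_bound.
Qed.

Let adj_free (m : lipfree o) : adj m \in @free_pred R M o.
Proof.
have [k [k0 Hk]] := lipf.
rewrite inE; apply/closure_normP => e e0.
have k1 : 0 < k + 1 by rewrite ltr_pwDr.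
have /set_mem/closure_normP/(_ _ (divr_gt0 e0 k1)) := valP m.
move=> [u Hu mu]; exists (adj u).
  case: Hu => n [a [s [Hs ->]]]; exists n, a, (adj \o s); split.
    move=> i; have [x _ xE] := Hs i; exists (f x) => //=.
    by rewrite -xE; exact/val_inj.
  by rewrite linear_sum; apply: eq_bigr => i _; rewrite linearZ.
rewrite -linearB (le_lt_trans (adj_norm k0 Hk _))//.
move: mu; rewrite ltr_pdivlMr//; apply: le_lt_trans.
by rewrite mulrC ler_wpM2l// lerDl.
Qed.

Let free_adj (m : lipfree o) : lipfree o := LipFree (adj_free m).

Let free_adj_linear : linear free_adj.
Proof. by move=> a m n; exact/val_inj/val_inj. Qed.

HB.instance Definition _ :=
  GRing.isLinear.Build R (lipfree o) (lipfree o) _ free_adj free_adj_linear.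

Lemma linearization_exists :
  exists T : {linear lipfree o -> lipfree o}, is_linearization T.
Proof.
have [k [k0 Hk]] := lipf; exists free_adj; split.
  by exists k; split=> // m; exact: adj_norm.
by move=> x; exact/val_inj/val_inj.
Qed.

(* A choice among linear maps satisfying [is_linearization]; by
   [linearization_unique] they are all equal as functions. *)
Definition linearization : {linear lipfree o -> lipfree o} :=
  projT1 (cid linearization_exists).

Lemma linearizationP : is_linearization linearization.
Proof. exact: projT2 (cid linearization_exists). Qed.

End linearization.

(* Main.v *)
(* For a linear map [T], [Per T] is a linear subspace: a common multiple of the
   periods of [u] and [v] is a period of [a *: u + v].  Hence its closure is a
   subspace too; it contains every [delta x], because [delta] is 1-Lipschitz,
   maps [Per f] into the periodic points of the linearization, and [Per f] is
   dense. *)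
Require Import Defs.
From mathcomp Require Import all_boot all_order all_algebra.
From mathcomp Require Import all_classical all_reals all_analysis.

Set Implicit Arguments.
Unset Strict Implicit.
Unset Printing Implicit Defensive.

Import Order.TTheory GRing.Theory Num.Theory.
Import numFieldNormedType.Exports.

Local Open Scope classical_set_scope.
Local Open Scope ring_scope.

Lemma iter_mul_fixed (X : Type) (F : X -> X) (m n : nat) (x : X) :
  iter n F x = x -> iter (m * n) F x = x.
Proof. by move=> Fx; elim: m => //= m IH; rewrite mulSn iterD IH. Qed.

Lemma iter_linear_combination (R : pzRingType) (V : lmodType R)
    (T : {linear V -> V}) (n : nat) (a : R) (u v : V) :
  iter n T (a *: u + v) = a *: iter n T u + iter n T v.
Proof. by elim: n => //= n ->; rewrite linearP. Qed.

Lemma Per_linear_combination (R : pzRingType) (V : lmodType R)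
    (T : {linear V -> V}) (a : R) (u v : V) :
  Per T u -> Per T v -> Per T (a *: u + v).
Proof.
move=> [m [m0 Tu]] [n [n0 Tv]]; exists (n * m)%N; rewrite muln_gt0 n0 m0.
split=> //; rewrite iter_linear_combination iter_mul_fixed// mulnC.
by rewrite iter_mul_fixed.
Qed.

Lemma linspan_Per (R : realType) (V : lmodType R) (T : {linear V -> V}) (u : V) :
  linspan (Per T) u -> Per T u.
Proof.
move=> [n [a [s [Ts ->]]]]; apply: big_ind => [|x y Tx Ty|i _].
(* Zero is fixed by [T], so it has period 1, the least that [Per] allows. *)
- by exists 1%N; rewrite /= linear0.
- by rewrite -[x]scale1r; exact: Per_linear_combination.
- rewrite -[_ *: _]addr0; apply: Per_linear_combination => //.
  by exists 1%N; rewrite /= linear0.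
Qed.

(** The norm is the dual one, and each [phi] varies by at most its Lipschitz norm times [mdist x y]
    between [x] and [y]. *)
Lemma delta_lipschitz (R : realType) (M : metricType R) (o x y : M) :
  `|delta o x - delta o y| <= mdist x y.
Proof.
apply: dual_norm_le => [|phi]; first exact: mdist_ge0.
by rewrite mulrC; exact: lip0_normP.
Qed.

Lemma dense_mdist (R : realType) (M : metricType R) (A : set M) (x : M) (e : R) :
  dense A -> 0 < e -> exists2 y, A y & mdist x y < e.
Proof.
(* [dense] tests nonempty open sets, hence the interior of the ball, which still contains [x]. *)
move=> dA e0; have [|y [/interior_subset xy Ay]] := dA (ball x e)° _ (open_interior _).
  by exists x; exact: nbhsx_ballx.
by exists y => //; move: xy; rewrite ballEmdist.
Qed.

Lemma Per_delta (R : realType) (M : metricType R) (o : M) (f : M -> M)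
    (T : lipfree o -> lipfree o) (x : M) :
  is_linearization f T -> Per f x -> Per T (delta o x).
Proof.
(* Expanding [x] on the right only leaves [iter n T (delta o x) = delta o (iter n f x)], which holds
   for every [n] by induction. *)
move=> [_ Td] [n [n0 fx]]; exists n; split=> //; rewrite -[in RHS]fx.
by elim: n {n0 fx} => //= n ->.
Qed.

Theorem proposition2p6 (R : realType) (M : metricType R) (o : M) (f : M -> M)
    (lipf : is_lipschitz f) (f0 : f o = o) :
  dense (Per f) -> dense (Per (linearization lipf f0)).
Proof.
move=> df; set T := linearization lipf f0.
(* With the span inside, [closure_linspan_submod] makes [C] a subspace; [linspan_Per] removes the
   span at the end. *)
pose C := closure (linspan (Per T)).
have C_delta x : C (delta o x).
  apply/closure_normP => e e0; have [y fy xy] := dense_mdist x df e0.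
  exists (delta o y); last exact: le_lt_trans (delta_lipschitz _ _ _) xy.
  exact/linspan_sub/(Per_delta (linearizationP lipf f0)).
have [C0 Clin] := closure_linspan_submod (Per T).
have C_sum n (a : 'I_n -> R) (x : 'I_n -> M) :
    C (\sum_(i < n) a i *: delta o (x i)).
  apply/set_mem; elim/big_ind: _ => [//|u v Cu Cv|i _].
    by rewrite -[u]scale1r; exact: Clin.
  by rewrite -[_ *: _]addr0; apply: Clin => //; exact/mem_set/C_delta.
move=> O [m Om] /(_ m Om) /nbhs_ballP[e /= e0 mO].
have e2 : 0 < e / 2 by rewrite divr_gt0.
(* One half of [e] pays for replacing [m] by a finite combination of deltas, the other for replacing
   that element of [C] by a periodic point. *)
have [n [a [x mx]]] := free_dense m e2.
have /closure_normP/(_ _ e2)[u /linspan_Per Tu xu] := C_sum n a x.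
exists u; split=> //; apply: mO; rewrite -ball_normE /=.
rewrite (splitr e) -(subrKA (\sum_(i < n) a i *: delta o (x i))).
exact: le_lt_trans (ler_normD _ _) (ltrD mx xu).
Qed.
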